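(* Choose any $\beta\in(0,1]$. Then for each value $E>0$ there exists a constant $\hat\lambda=\hat\lambda(\beta,E)>0$ such that for all $\lambda\in(0,\hat\lambda)$ the problem \[ -\Delta u=\lambda ue^{u^2+\alpha|u|^\beta}\ \text{in }B,\qquad u=0\ \text{on }\partial B \] admits no radial nodal solution $u$ with $\int_B|\nabla u|^2dx\le E$. In particular, for each number $k\in\mathbb{N}$ there is a value $\hat\lambda_0=\hat\lambda_0(\beta,k)>0$ such that for all $\lambda\in(0,\hat\lambda_0)$ there exists no solution $u\in S_{k,\lambda,\beta}$ which attains $c_{k,\lambda,\beta}$ (i.e. with $I_{\lambda,\beta}(u)=c_{k,\lambda,\beta}$).
   Context: $B\subset\mathbb{R}^2$ is the open unit ball centered at the origin, $\alpha>0$ is fixed, $\mathbb{N}=\{1,2,\dots\}$. Let $(P_{\lambda,\beta})$ denote the displayed problem, for $(\lambda,\beta)\in(0,\infty)\times(0,2)$. For $k\in\{0\}\cup\mathbb{N}$, $S_{k,\lambda,\beta}$ is the set of radial solutions $u\in C^2(B)\cap C^0(\overline{B})$ of $(P_{\lambda,\beta})$ for which there are numbers $0=r_0<r_1<\dots<r_{k+1}=1$ such that, for all $1\le i\le k+1$, $u(x)=0$ if $|x|=r_i$ and $\mathrm{sgn}(u(0))(-1)^{i-1}u>0$ on $\{r_{i-1}<|x|<r_i\}$. A radial nodal solution is an element of $S_{k,\lambda,\beta}$ for some $k\in\mathbb{N}$. $I_{\lambda,\beta}(u)=\frac12\int_B|\nabla u|^2dx-\lambda\int_BF_\beta(u)dx$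 on $H^1_0(B)$, with $F_\beta(t)=\int_0^tse^{s^2+\alpha|s|^\beta}ds$. $\mathcal{N}_{\lambda,\beta}$ is the set of radially symmetric $u\in H^1_0(B)$ with $\langle I'_{\lambda,\beta}(u),u\rangle=0$. The number $c_{k,\lambda,\beta}$ is the infimum of $I_{\lambda,\beta}(u)$ over all $u\in\mathcal{N}_{\lambda,\beta}$ for which there are $0=r_0<r_1<\dots<r_{k+1}=1$ such that, for all $1\le i\le k+1$, $u(x)=0$ if $|x|=r_i$, $u_i:=u|_{\{r_{i-1}<|x|<r_i\}}$ satisfies $(-1)^{i-1}u_i>0$, and $u_i$ extended by zero belongs to $\mathcal{N}_{\lambda,\beta}$. *)

(* Defs.v *)
From mathcomp Require Import all_boot all_order all_algebra.
From mathcomp Require Import all_classical all_reals all_analysis.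

Set Implicit Arguments.
Unset Strict Implicit.
Unset Printing Implicit Defensive.

Import Order.TTheory GRing.Theory Num.Theory.
Import numFieldNormedType.Exports.

Local Open Scope classical_set_scope.
Local Open Scope ring_scope.

Section Plane.
Context {R : realType}.

Notation plane := (measurableTypeR R * measurableTypeR R)%type.

Notation leb2 := (@lebesgue_measure R \x @lebesgue_measure R)%E.

(* The Euclidean norm; the library's norm on R * R is the max norm. *)
Definition norm2 (x : R * R) : R := Num.sqrt (x.1 ^+ 2 + x.2 ^+ 2).

Definition disk : set (R * R) := [set x | norm2 x < 1].
Definition cdisk : set (R * R) := [set x | norm2 x <= 1].
Definition annulus (a b : R) : set (R * R) := [set x | a < norm2 x < b].

Definition e1 : R * R := (1, 0).
Definition e2 : R * R := (0, 1).

Fixpoint class_C (n : nat) (A : set (R * R)) (u : R * R -> R) : Prop :=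
  (forall x, A x -> {for x, continuous u}) /\
  if n is m.+1 then
    [/\ forall x, A x -> derivable u x e1 /\ derivable u x e2,
        class_C m A ('D_e1 u) & class_C m A ('D_e2 u)]
  else True.

Definition laplacian (u : R * R -> R) (x : R * R) : R :=
  'D_e1 ('D_e1 u) x + 'D_e2 ('D_e2 u) x.

(* The support is automatically compact, the disk being bounded. *)
Definition test_function (phi : R * R -> R) : Prop :=
  (forall n, class_C n setT phi) /\ closure [set x | phi x != 0] `<=` disk.

Definition L2 (u : R * R -> R) : Prop :=
  measurable_fun (disk : set plane) (u : plane -> R) /\
  (\int[leb2]_(x in disk) (u x ^+ 2)%:E < +oo)%E.

Definition is_weak_deriv (e : R * R) (u g : R * R -> R) : Prop :=
  L2 g /\
  forall phi, test_function phi ->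
    \int[leb2]_(x in disk) (u x * 'D_e phi x) =
    - \int[leb2]_(x in disk) (g x * phi x).

(* Weak derivatives are unique up to a null set; one of them is selected. *)
Definition weak_deriv (e : R * R) (u : R * R -> R) : R * R -> R :=
  xget (fun=> 0) [set g | is_weak_deriv e u g].

Definition H1 (u : R * R -> R) : Prop :=
  [/\ L2 u, exists g, is_weak_deriv e1 u g & exists g, is_weak_deriv e2 u g].

(* The closure of the test functions in the H1 norm. *)
Definition H10 (u : R * R -> R) : Prop :=
  H1 u /\
  forall eps : R, 0 < eps -> exists2 phi, test_function phi &
    (\int[leb2]_(x in disk)
       ((u x - phi x) ^+ 2 + (weak_deriv e1 u x - 'D_e1 phi x) ^+ 2
        + (weak_deriv e2 u x - 'D_e2 phi x) ^+ 2)%:E < eps%:E)%E.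

Definition radial_on (A : set (R * R)) (u : R * R -> R) : Prop :=
  forall x y, A x -> A y -> norm2 x = norm2 y -> u x = u y.

Definition nonlin (alpha beta : R) (s : R) : R :=
  s * expR (s ^+ 2 + alpha * (`|s| `^ beta)).

(* The oriented integral of the nonlinearity from 0 to t. *)
Definition primF (alpha beta : R) (t : R) : R :=
  if 0 <= t then \int[lebesgue_measure]_(s in `[0, t]) nonlin alpha beta s
  else - \int[lebesgue_measure]_(s in `[t, 0]) nonlin alpha beta s.

Definition energy (alpha beta lambda : R) (u : R * R -> R) : R :=
  2^-1 * \int[leb2]_(x in disk)
           (weak_deriv e1 u x ^+ 2 + weak_deriv e2 u x ^+ 2)
  - lambda * \int[leb2]_(x in disk) primF alpha beta (u x).

(* <I'(u), v> = l. The functional is continuously differentiable on H10, so its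
   derivative at u, applied to v, is the directional derivative. *)
Definition energy_deriv (alpha beta lambda : R) (u v : R * R -> R) (l : R) :
    Prop :=
  is_derive (0 : R) (1 : R)
    (fun t : R => energy alpha beta lambda (fun x => u x + t * v x)) l.

Definition nehari (alpha beta lambda : R) (u : R * R -> R) : Prop :=
  [/\ H10 u, radial_on disk u & energy_deriv alpha beta lambda u u 0].

Definition radii (k : nat) (r : nat -> R) : Prop :=
  [/\ r 0%N = 0, r k.+1 = 1 & forall i, (i <= k)%N -> r i < r i.+1].

(* Elements of H10 are classes modulo null sets, but a radial one has a unique
   representative continuous on the closed disk minus the origin. The pointwise
   conditions below are about that representative. *)
Definition nodal_nehari (alpha beta lambda : R) (k : nat) (u : R * R -> R) :
    Prop :=
  [/\ nehari alpha beta lambda u,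
      {within cdisk `\ (0, 0), continuous u} &
      exists2 r, radii k r &
        forall i, (1 <= i <= k.+1)%N ->
          [/\ forall x, norm2 x = r i -> u x = 0,
              forall x, annulus (r i.-1) (r i) x -> 0 < (-1) ^+ i.-1 * u x &
              nehari alpha beta lambda (u \_ (annulus (r i.-1) (r i)))]].

(* Extended-real valued, so that the infimum of the empty set is +oo. *)
Definition c_level (alpha beta lambda : R) (k : nat) : \bar R :=
  ereal_inf [set (energy alpha beta lambda u)%:E
            | u in nodal_nehari alpha beta lambda k].

Definition solution (alpha beta lambda : R) (u : R * R -> R) : Prop :=
  [/\ class_C 2 disk u,
      {within cdisk, continuous u},
      forall x, disk x -> - laplacian u x =
        lambda * u x * expR (u x ^+ 2 + alpha * (`|u x| `^ beta)) &
      forall x, norm2 x = 1 -> u x = 0].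

Definition S_ (alpha beta lambda : R) (k : nat) (u : R * R -> R) : Prop :=
  [/\ solution alpha beta lambda u,
      radial_on cdisk u &
      exists2 r, radii k r &
        forall i, (1 <= i <= k.+1)%N ->
          (forall x, norm2 x = r i -> u x = 0) /\
          (forall x, annulus (r i.-1) (r i) x ->
             0 < Num.sg (u (0, 0)) * (-1) ^+ i.-1 * u x)].

Definition radial_nodal_solution (alpha beta lambda : R) (u : R * R -> R) :
    Prop :=
  exists2 k, (1 <= k)%N & S_ alpha beta lambda k u.

(* The Dirichlet integral with classical derivatives, possibly +oo. *)
Definition dirichlet (u : R * R -> R) : \bar R :=
  (\int[leb2]_(x in disk) ('D_e1 u x ^+ 2 + 'D_e2 u x ^+ 2)%:E)%E.

End Plane.

(* Main.v *)
Require Import Defs.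
From mathcomp Require Import all_boot all_order all_algebra.
From mathcomp Require Import all_classical all_reals all_analysis.
From mathcomp Require Import ring lra.

Set Implicit Arguments.
Unset Strict Implicit.
Unset Printing Implicit Defensive.

Import Order.TTheory GRing.Theory Num.Theory.
Import numFieldNormedType.Exports.

Local Open Scope classical_set_scope.
Local Open Scope ring_scope.

(** For lambda below a threshold depending only on alpha and beta there is no
    radial nodal solution at all; both claims follow from this.

    Restrict u to a ray, with the sign that makes it positive at the origin:
    this gives v with (x v')' = - lambda x f(v), f(y) = y exp(y^2 + alpha
    |y|^beta). Let r be its first zero, S = - r v'(r) the flux through the circle
    of radius r, and L = ln (1 / r). Everything depends on the product S L,
    because |v| <= S ln (x / r) <= S L on the second nodal domain.

    If S L <= alpha + 1, then v is bounded on the second domain by a constant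
    that does not depend on lambda, and for small lambda the right-hand side of
    the equation is too small to bring v back to zero within the unit disk;
    comparison with 2 - x^2 proves it (annulus_flux_log_gt).

    If S L > alpha + 1, the first nodal domain cannot exist (core_flux_log_le).
    Write P(x) = - x v'(x) for the flux, which increases from 0 to S. The picture
    is that a bubble of height m at the origin produces the flux 2 / m, and that
    P is then nearly constant, so that v is nearly S ln (r / x). Where v <= 2 / S
    one has v^2 <= 2 ln (r / x), hence x^2 exp(v^2) <= r^2 = exp(- 2 L). The
    remaining factors of f are at most exponential in 1 / S because beta <= 1,
    and exp(- 2 L) beats them as L > (alpha + 1) / S. So at the point where
    v = 2 / S, or at the origin if v is smaller throughout, P is still S up to a
    higher order in S (core_flux_sqr_le). At the origin this is absurd, the flux
    being 0 there. Otherwise the bubble would have to produce too much: a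
    monotone quantity of Pohozaev type shows that P is less than 2 / v at every
    height v >= 1, with a definite margin (core_flux_above), hence less than S at
    the height 2 / S. *)

(** * Monotonicity and calculus on the real line *)

Lemma is_derive_continuous (R : realType) (f : R -> R) (x df : R) :
  is_derive x 1 f df -> {for x, continuous f}.
Proof.
by case=> df1 _; apply: differentiable_continuous; apply/derivable1_diffP.
Qed.

Lemma ge0_derive_le (R : realType) (f df : R -> R) (a b : R) : a <= b ->
    (forall x : R, a < x < b -> is_derive x 1 f (df x)) ->
    (forall x : R, a < x < b -> 0 <= df x) ->
    {within `[a, b], continuous f} ->
  f a <= f b.
Proof.
rewrite le_eqVlt => /predU1P[-> //|ab] fdf df0 cf.
have fdf' x : x \in `]a, b[%R -> is_derive x 1 f (df x).
  by rewrite in_itv /=; exact: fdf.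
have [c] := MVT ab fdf' cf; rewrite in_itv /= => cab fab.
by rewrite -subr_ge0 fab mulr_ge0 ?df0 ?subr_ge0 ?ltW.
Qed.

Lemma le0_derive_ge (R : realType) (f df : R -> R) (a b : R) : a <= b ->
    (forall x : R, a < x < b -> is_derive x 1 f (df x)) ->
    (forall x : R, a < x < b -> df x <= 0) ->
    {within `[a, b], continuous f} ->
  f b <= f a.
Proof.
rewrite le_eqVlt => /predU1P[-> //|ab] fdf df0 cf.
have fdf' x : x \in `]a, b[%R -> is_derive x 1 f (df x).
  by rewrite in_itv /=; exact: fdf.
have [c] := MVT ab fdf' cf; rewrite in_itv /= => cab fab.
by rewrite -subr_le0 fab mulr_le0_ge0 ?df0 ?subr_ge0 ?ltW.
Qed.

Lemma within_itv_continuous (R : realType) (f : R -> R) (a b : R) :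
  (forall x : R, a <= x <= b -> {for x, continuous f}) ->
  {within `[a, b], continuous f}.
Proof.
move=> cf; apply: continuous_in_subspaceT => x.
by rewrite inE /= in_itv /=; exact: cf.
Qed.

(** The rules of calculus for functions written pointwise, so that a derivative
    is assembled as a term following the syntax of the function. *)
Section pointwise.
Context {R : realType}.
Implicit Types (f g : R -> R) (x a b : R).

Lemma der1D f g x a b : is_derive x 1 f a -> is_derive x 1 g b ->
  is_derive x 1 (fun t => f t + g t) (a + b).
Proof. by move=> fa gb; exact: is_deriveD. Qed.

Lemma der1B f g x a b : is_derive x 1 f a -> is_derive x 1 g b ->
  is_derive x 1 (fun t => f t - g t) (a - b).
Proof. by move=> fa gb; exact: is_deriveB. Qed.

Lemma der1M f g x a b : is_derive x 1 f a -> is_derive x 1 g b ->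
  is_derive x 1 (fun t => f t * g t) (f x * b + g x * a).
Proof. by move=> fa gb; exact: is_deriveM. Qed.

Lemma der1_sqr f x a : is_derive x 1 f a ->
  is_derive x 1 (fun t => f t ^+ 2) (2 * f x * a).
Proof. by move=> fa; apply: (is_derive_eq (der1M fa fa)); ring. Qed.

Lemma der1_cst (c x : R) : is_derive x 1 (fun=> c) 0.
Proof. exact: is_derive_cst. Qed.

Lemma der1_id (x : R) : is_derive x 1 (fun t => t) 1.
Proof. exact: is_derive_id. Qed.

Lemma der1V f x a : f x != 0 -> is_derive x 1 f a ->
  is_derive x 1 (fun t => (f t)^-1) (- a / f x ^+ 2).
Proof.
move=> fx fa; apply: (is_derive_eq (is_deriveV fx fa)).
by rewrite /GRing.scale /= mulNr mulrC mulNr.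
Qed.

Lemma der1_comp f g x a b : is_derive (g x) 1 f a -> is_derive x 1 g b ->
  is_derive x 1 (fun t => f (g t)) (a * b).
Proof. by move=> fa gb; exact: is_derive1_comp. Qed.
End pointwise.

(** The only place where beta <= 1 matters: the perturbation of y ^+ 2 in the
    exponent of the nonlinearity grows at most linearly. *)
Lemma powR_le1D (R : realType) (b y : R) : 0 < b <= 1 -> 0 <= y ->
  y `^ b <= 1 + y.
Proof.
move=> /andP[b0 b1] y0; have [y1|/ltW y1] := leP 1 y.
  by apply: (le_trans (ler1_powR _ _)) => //; lra.
have : y `^ b <= 1 `^ b by apply: ge0_ler_powR; rewrite ?nnegrE //; lra.
by rewrite powR1; lra.
Qed.

Lemma is_derive_nonlin (R : realType) (alpha beta y : R) : 0 < y ->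
  is_derive y 1 (nonlin alpha beta)
   ((1 + 2 * y ^+ 2 + alpha * beta * y `^ beta)
    * expR (y ^+ 2 + alpha * (`|y| `^ beta))).
Proof.
move=> y0.
apply: (@near_eq_is_derive R R R
  (fun s : R => s * expR (s ^+ 2 + alpha * (s `^ beta)))).
  near=> s; rewrite /nonlin gtr0_norm //.
  by near: s; exact: lt_nbhsr.
have yn0 : y != 0 by rewrite gt_eqF.
rewrite gtr0_norm //.
have e := der1D (der1_sqr (der1_id y))
  (der1M (der1_cst alpha y) (is_derive1_powR beta y0)).
apply: (is_derive_eq (der1M (der1_id y) (der1_comp (@is_derive_expR _ _) e))).
have -> : y `^ beta = y * y `^ (beta - 1).
  by rewrite -{2}(powRr1 (ltW y0)) -powRD ?yn0 ?implybT // addrC subrK.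
ring.
Unshelve. all: by end_near.
Qed.

(** * The radial equation on the innermost nodal domain *)

Section radial_equation.
Context {R : realType}.
Implicit Types (a b r t x y z : R) (v P : R -> R) (alpha beta lambda : R).

Lemma nonlin_gt0 alpha beta y : 0 < y -> 0 < nonlin alpha beta y.
Proof. by move=> y0; rewrite /nonlin mulr_gt0 ?expR_gt0. Qed.

Lemma nonlin_le alpha beta y : 0 < alpha -> 0 < beta <= 1 -> 0 <= y ->
  nonlin alpha beta y <= y * expR (y ^+ 2 + alpha * (1 + y)).
Proof.
move=> alpha0 beta01 y0; rewrite /nonlin ger0_norm // ler_wpM2l // ler_expR.
rewrite lerD2l.
by rewrite ler_pM2l //; exact: powR_le1D.
Qed.

Lemma nonlin_homo alpha beta x y : 0 < alpha -> 0 < beta <= 1 ->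
  0 <= x -> x <= y -> nonlin alpha beta x <= nonlin alpha beta y.
Proof.
move=> alpha0 beta01 x0 xy; have y0 : 0 <= y by lra.
rewrite /nonlin (ger0_norm x0) (ger0_norm y0).
apply: (ler_pM x0 (expR_ge0 _) xy).
rewrite ler_expR; apply: lerD.
  by rewrite lerXn2r ?nnegrE.
rewrite ler_pM2l //; apply: ge0_ler_powR; rewrite ?nnegrE //.
by case/andP: beta01 => /ltW.
Qed.

Lemma nonlinN alpha beta y : nonlin alpha beta (- y) = - nonlin alpha beta y.
Proof. by rewrite /nonlin sqrrN normrN mulNr. Qed.

(** The equation (x v')' = - lambda x f(v) as a first-order system. The flux
    P x = - x v'(x) replaces v' because it is continuous up to the origin, where
    it vanishes, and because its derivative has the sign of v. *)
Definition radial_ode alpha beta lambda b v P :=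
  forall x, 0 < x < b ->
    is_derive x 1 v (- P x / x) /\
    is_derive x 1 P (lambda * x * nonlin alpha beta (v x)).

(** The system holds on an interval larger than the domain of positivity, so
    that v and P are differentiable at its end r too. *)
Record positive_core alpha beta lambda r v P : Prop := PositiveCore {
  core_params : [/\ 0 < alpha, 0 < beta <= 1 & 0 < lambda];
  core_r : 0 < r <= 1;
  core_ode : exists2 b, r < b & radial_ode alpha beta lambda b v P;
  core_cv : {for 0, continuous v};
  core_cP : {for 0, continuous P};
  core_P0 : P 0 = 0;
  core_vr : v r = 0;
  core_gt0 : forall x, 0 <= x < r -> 0 < v x }.

Section core.
Variables (alpha beta lambda r : R) (v P : R -> R).
Notation f := (nonlin alpha beta).
Notation core := (positive_core alpha beta lambda r v P).

Lemma core_derive x : core -> 0 < x <= r ->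
  is_derive x 1 v (- P x / x) /\ is_derive x 1 P (lambda * x * f (v x)).
Proof. by move=> [_ _ [b rb ode] *]; apply: ode; lra. Qed.

Lemma core_continuous x : core -> 0 <= x <= r ->
  {for x, continuous v} /\ {for x, continuous P}.
Proof.
move=> H /andP[]; rewrite le_eqVlt => /predU1P[<- _|x0 xr].
  by split; [exact: core_cv H|exact: core_cP H].
have /(core_derive H)[dv dP] : 0 < x <= r by rewrite x0.
by split; apply: is_derive_continuous.
Qed.

Lemma core_flux_homo x y : core -> 0 <= x -> x <= y -> y <= r -> P x <= P y.
Proof.
move=> H; have [al0 be01 la0] := core_params H.
have [r0 r1] := andP (core_r H).
move=> x0 xy yr; apply: (ge0_derive_le xy) => [z xzy|z xzy|].
- by apply: (core_derive H _).2; lra.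
- have zr : 0 <= z < r by lra.
  have fz := nonlin_gt0 alpha beta (core_gt0 H zr).
  by rewrite mulr_ge0 ?(ltW fz) // mulr_ge0 //; lra.
- by apply: within_itv_continuous => z xzy; apply: (core_continuous H _).2; lra.
Qed.

Lemma core_flux_ge0 x : core -> 0 <= x <= r -> 0 <= P x.
Proof.
by move=> H /andP[x0 xr]; rewrite -(core_P0 H) (core_flux_homo H).
Qed.

Lemma core_nincr x y : core -> 0 <= x -> x <= y -> y <= r -> v y <= v x.
Proof.
move=> H; have [al0 be01 la0] := core_params H.
have [r0 r1] := andP (core_r H).
move=> x0 xy yr; apply: (@le0_derive_ge _ v (fun z => - P z / z) _ _ xy)
  => [z xzy|z xzy|].
- by apply: (core_derive H _).1; lra.
- have ? : 0 <= P z by apply: (core_flux_ge0 H); lra.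
  by rewrite mulNr oppr_le0 divr_ge0 //; lra.
- by apply: within_itv_continuous => z xzy; apply: (core_continuous H _).1; lra.
Qed.

(** The main estimate: where v >= 1, P <= 1 / h(v), h(y) = y / 2 + 1 / (4 y).
    Put K = P - (lambda / 2) x^2 f(v) - h(v) P^2. By the equation
      K' = (lambda / 2) x P (f' - 4 h f)(v) + h'(v) P^3 / x.
    Here h' >= 0 on [1, oo), and 4 h(y) = 2 y + 1 / y is the logarithmic
    derivative of y exp(y^2), hence at most that of f, as alpha >= 0. So K
    increases from K 0 = 0, and K >= 0 gives P >= h(v) P^2. The gain over the
    bound 2 / v, due to the term 1 / (4 y), is what core_flux_log_le needs. *)
Lemma core_flux_above a : core -> 0 <= a -> a < r -> 1 <= v a ->
  P a * (2 * v a ^+ 2 + 1) <= 4 * v a.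
Proof.
move=> H; have [al0 be01 la0] := core_params H.
have [r0 r1] := andP (core_r H).
move=> a0 ar va1.
pose K x := P x - lambda / 2 * x ^+ 2 * f (v x)
  - (v x / 2 + 4^-1 * (v x)^-1) * P x ^+ 2.
have va x : 0 <= x <= a -> 1 <= v x.
  by move=> xa; apply: le_trans va1 _; apply: (core_nincr H); lra.
pose e y := expR (y ^+ 2 + alpha * (`|y| `^ beta)).
pose dK x := (lambda / 2 * x * P x * (alpha * beta * v x `^ beta * e (v x)))
  + (2^-1 - 4^-1 / v x ^+ 2) * (P x ^+ 3 / x).
have : K 0 <= K a.
  apply: (@ge0_derive_le _ _ dK) => // [x xa|x xa|].
  - have x0 : x != 0 by lra.
    have vx1 : 1 <= v x by apply: va; lra.
    have vx0 : v x != 0 by lra.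
    have dvx : is_derive x 1 v (- P x / x) by apply: (core_derive H _).1; lra.
    have dPx : is_derive x 1 P (lambda * x * f (v x)).
      by apply: (core_derive H _).2; lra.
    have vxgt0 : 0 < v x by lra.
    have dN :=
      der1M (der1M (der1_cst (lambda / 2) x) (der1_sqr (der1_id x)))
      (der1_comp (is_derive_nonlin alpha beta vxgt0) dvx).
    have dh := der1D (der1M dvx (der1_cst 2^-1 x))
      (der1M (der1_cst 4^-1 x) (der1V vx0 dvx)).
    apply: (is_derive_eq (der1B (der1B dPx dN) (der1M dh (der1_sqr dPx)))).
    rewrite /dK /nonlin -/(e (v x)); set E := e _; set p := _ `^ _.
    by field; rewrite x0 vx0.
  - have vx1 : 1 <= v x by apply: va; lra.
    have Px : 0 <= P x by apply: (core_flux_ge0 H); lra.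
    rewrite addr_ge0 //.
      by rewrite !mulr_ge0 ?expR_ge0 ?powR_ge0 //; lra.
    rewrite mulr_ge0 ?divr_ge0 ?exprn_ge0 //; last lra.
    rewrite subr_ge0 ler_pdivrMr ?exprn_gt0 //; last lra.
    by nra.
  - apply: within_itv_continuous => x xa.
    have vx1 : 1 <= v x by apply: va; lra.
    have cPx : {for x, continuous P} by apply: (core_continuous H _).2; lra.
    have cvx : {for x, continuous v} by apply: (core_continuous H _).1; lra.
    have cN : {for x, continuous (fun t => f (v t))}.
      apply: (@continuous_comp _ _ _ v f) => //.
      by apply: is_derive_continuous (is_derive_nonlin _ _ _); lra.
    apply: cvgB; first apply: cvgB => //.
      apply: cvgM => //; apply: cvgM; first exact: cvg_cst.
      by apply: cvgM; exact: cvg_id.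
    apply: cvgM; last by apply: cvgM.
    apply: cvgD; first by apply: cvgM => //; exact: cvg_cst.
    apply: cvgM; first exact: cvg_cst.
    by apply: cvgV => //; lra.
rewrite {1}/K (core_P0 H) expr0n /= !(mulr0, mul0r, subr0) /K => Ka.
have N0 : 0 <= lambda / 2 * a ^+ 2 * f (v a).
  have va0 : 0 < v a by lra.
  rewrite mulr_ge0 ?(ltW (nonlin_gt0 _ _ va0)) //.
  by rewrite mulr_ge0 ?exprn_ge0 //; lra.
have Pa : 0 <= P a by apply: (core_flux_ge0 H); lra.
have hPa : P a * (P a * (2 * v a ^+ 2 + 1)) <= P a * (4 * v a).
  have -> : P a * (P a * (2 * v a ^+ 2 + 1)) =
      4 * v a * ((v a / 2 + 4^-1 * (v a)^-1) * P a ^+ 2).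
    by field; lra.
  by rewrite [leRHS]mulrC ler_pM2l //; lra.
move: Pa; rewrite le_eqVlt => /predU1P[<-|Pagt0]; first by rewrite mul0r; lra.
by rewrite ler_pM2l in hPa.
Qed.

(** The flux is largest at r, so v lies below the logarithm with flux P r that
    vanishes at r. *)
Lemma core_le_log x : core -> 0 < x <= r -> v x <= P r * (ln r - ln x).
Proof.
move=> H; have [al0 be01 la0] := core_params H.
have [r0 r1] := andP (core_r H).
move=> /andP[x0 xr].
have : v x + P r * ln x <= v r + P r * ln r.
  apply: (@ge0_derive_le _ (fun t => v t + P r * ln t)
      (fun t => - P t / t + (P r * t^-1 + ln t * 0))) => // [t xt|t xt|].
  - have t0 : 0 < t by lra.
    apply: der1D; first by apply: (core_derive H _).1; lra.
    exact: der1M (der1_cst (P r) t) (is_derive1_ln t0).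
  - rewrite mulr0 addr0 -mulrDl divr_ge0 //; last by lra.
    by have := @core_flux_homo t r H; lra.
  - apply: within_itv_continuous => t xt.
    apply: cvgD; first by apply: (core_continuous H _).1; lra.
    apply: cvgM; first exact: cvg_cst.
    by apply: continuous_ln; lra.
by rewrite (core_vr H); lra.
Qed.

(** Integrate P' = lambda x f(v) <= lambda x f(Y) from a to r. *)
Lemma core_flux_below a Y : core -> 0 <= a -> a < r -> v a <= Y ->
  P r <= P a + lambda * f Y / 2.
Proof.
move=> H; have [al0 be01 la0] := core_params H.
have [r0 r1] := andP (core_r H).
move=> a0 ar vaY.
pose c := lambda * f Y / 2.
have : P r - c * r ^+ 2 <= P a - c * a ^+ 2.
  apply: (@le0_derive_ge _ (fun t => P t - c * t ^+ 2)
     (fun t => lambda * t * f (v t) - (c * (2 * t * 1) + t ^+ 2 * 0)));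
    first exact: ltW.
  - move=> t tar; apply: der1B; first by apply: (core_derive H _).2; lra.
    exact: der1M (der1_cst c t) (der1_sqr (der1_id t)).
  - move=> t tar.
    have vt : 0 < v t by apply: (core_gt0 H); lra.
    have vtY : v t <= Y by apply: le_trans vaY; apply: (core_nincr H); lra.
    have lat : 0 <= lambda * t by rewrite mulr_ge0 // ltW //; lra.
    have ffY : f (v t) <= f Y by apply: nonlin_homo; lra.
    have -> : lambda * t * f (v t) - (c * (2 * t * 1) + t ^+ 2 * 0) =
        lambda * t * (f (v t) - f Y) by rewrite /c; field.
    by apply: mulr_ge0_le0 lat _; rewrite subr_le0.
  - apply: within_itv_continuous => t tar.
    apply: cvgB; first by apply: (core_continuous H _).2; lra.
    apply: cvgM; first exact: cvg_cst.
    by apply: cvgM; exact: cvg_id.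
have c0 : 0 <= c.
  have := core_gt0 H; move/(_ a); rewrite a0 ar => /(_ isT) va0.
  have Y0 : 0 < Y by lra.
  by have := nonlin_gt0 alpha beta Y0; rewrite /c; nra.
rewrite -/c => Pc.
have : c * (r ^+ 2 - a ^+ 2) <= c * 1 by rewrite ler_wpM2l //; nra.
lra.
Qed.

(** Either v stays below Y and the region v <= Y starts at the origin, where the
    flux vanishes, or it starts where v = Y, where core_flux_above controls the
    flux. *)
Lemma core_level Y : core -> 0 < Y -> exists2 a, 0 <= a < r &
  v a <= Y /\ (a = 0 \/ v a = Y).
Proof.
move=> H; have [al0 be01 la0] := core_params H.
have [r0 r1] := andP (core_r H).
move=> Y0; have [vY|/ltW vY] := leP (v 0) Y.
  by exists 0; [rewrite lexx r0|split => //; left].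
have [||a] := @IVT _ v 0 r Y (ltW r0).
- by apply: within_itv_continuous => t tr; exact: (core_continuous H tr).1.
- by rewrite (core_vr H) ge_min le_max vY (ltW Y0) orbT.
rewrite in_itv /= => a0r vaY; exists a; last by rewrite vaY; split=> //; right.
have : a != r by apply: contra_eqN vaY => /eqP ->; rewrite (core_vr H); lra.
by lra.
Qed.

(** At the level v = 2 core_flux_above gives P <= 8 / 9, and below it the flux
    gains at most 1 / 9. *)
Lemma core_flux_le1 : core -> 9 * lambda * f 2 <= 2 -> P r <= 1.
Proof.
move=> H; have [al0 be01 la0] := core_params H.
have [r0 r1] := andP (core_r H).
move=> lam; have [a /andP[a0 ar] [va vaE]] := core_level H (ltr0Sn _ 1).
have := core_flux_below H a0 ar va.
have : P a <= 8 / 9.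
  case: vaE => [->|va2]; first by rewrite (core_P0 H); lra.
  have := core_flux_above H a0 ar; rewrite va2; lra.
lra.
Qed.

(** On the region v <= Y <= 2 / P r, core_le_log gives
    v^2 <= Y P(r) ln (r / x) <= 2 ln (r / x), so exp(v^2) <= (r / x)^2. Hence
    P' <= C / x with C = lambda Y exp(alpha (1 + Y)) r^2. This is not integrable
    at 0, but P P' <= C P / x = - C v' is: P^2 + 2 C v is nonincreasing. *)
Lemma core_flux_sqr_le a Y : core -> 0 < Y -> 0 <= a -> a < r -> v a <= Y ->
    P r * Y <= 2 ->
  P r ^+ 2 <= P a ^+ 2
    + 2 * (lambda * Y * expR (alpha * (1 + Y)) * r ^+ 2) * v a.
Proof.
move=> H Y0 a0 ar vaY SY.
have [al0 be01 la0] := core_params H.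
have [r0 r1] := andP (core_r H).
set C := lambda * Y * _ * _.
have : P r ^+ 2 + 2 * C * v r <= P a ^+ 2 + 2 * C * v a.
  apply: (@le0_derive_ge _ (fun t => P t ^+ 2 + 2 * C * v t)
    (fun t => 2 * P t * (lambda * t * f (v t))
       + (2 * C * (- P t / t) + v t * 0))); first exact: ltW.
  - move=> t tar; have /(core_derive H)[dvt dPt] : 0 < t <= r by lra.
    exact: der1D (der1_sqr dPt) (der1M (der1_cst (2 * C) t) dvt).
  - move=> t tar.
    have t0 : 0 < t by lra.
    have vt : 0 < v t by apply: (core_gt0 H); lra.
    have vtY : v t <= Y by apply: le_trans vaY; apply: (core_nincr H); lra.
    have vtln : v t <= P r * (ln r - ln t) by apply: (core_le_log H); lra.
    have Pt : 0 <= P t by apply: (core_flux_ge0 H); lra.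
    have v2 : v t ^+ 2 <= 2 * ln r - 2 * ln t.
      have lnrt : 0 <= ln r - ln t by rewrite subr_ge0 ler_ln ?posrE //; lra.
      have : v t ^+ 2 <= Y * (P r * (ln r - ln t)).
        by rewrite expr2 ler_pM //; lra.
      have : P r * Y * (ln r - ln t) <= 2 * (ln r - ln t) by rewrite ler_wpM2r.
      lra.
    have ft : f (v t) <= Y * expR (alpha * (1 + Y)) * (r ^+ 2 / t ^+ 2).
      apply: le_trans (nonlin_le al0 be01 (ltW vt)) _.
      rewrite -mulrA; apply: ler_pM => //; rewrite ?expR_ge0 ?(ltW vt) //.
      have -> : r ^+ 2 / t ^+ 2 = expR (2 * ln r - 2 * ln t).
        by rewrite expRB !expRM_natl !lnK ?posrE.
      rewrite -expRD ler_expR.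
      have : alpha * (1 + v t) <= alpha * (1 + Y) by rewrite ler_pM2l // lerD2l.
      lra.
    have Ct : lambda * t * f (v t) <= C / t.
      have -> : C / t = lambda * t *
          (Y * expR (alpha * (1 + Y)) * (r ^+ 2 / t ^+ 2)).
        by rewrite /C; field; lra.
      by rewrite ler_wpM2l // mulr_ge0 // ltW.
    have -> : 2 * P t * (lambda * t * f (v t)) +
        (2 * C * (- P t / t) + v t * 0) =
        2 * P t * (lambda * t * f (v t) - C / t) by field; lra.
    by rewrite mulr_ge0_le0 ?mulr_ge0 ?subr_le0.
  - apply: within_itv_continuous => t tar.
    have /(core_continuous H)[cvt cPt] : 0 <= t <= r by lra.
    apply: cvgD; first by apply: cvgM.
    by apply: cvgM => //; exact: cvg_cst.
by rewrite (core_vr H) mulr0 addr0.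
Qed.

(** Write S = P r and suppose S ln (1 / r) > alpha + 1. Then r^2 is so small
    that the constant C of core_flux_sqr_le at the level Y = 2 / S is O(S^5): the
    region v <= 2 / S contributes only a term of order S^4 to S^2. So v exceeds
    2 / S, and the flux p at that level satisfies p^2 >= S^2 - O(S^4) with a
    small constant, whereas core_flux_above gives p <= 8 S / (8 + S^2), whose
    square is less than S^2 by about S^4 / 4. *)
Lemma core_flux_log_le : core ->
    9 * lambda * f 2 <= 2 -> 486 * (lambda * expR alpha) <= 1 ->
  P r * - ln r <= alpha + 1.
Proof.
move=> H lam2 lam; rewrite leNgt; apply/negP => Sln.
have [al0 be01 la0] := core_params H.
have [r0 r1] := andP (core_r H).
have S1 := core_flux_le1 H lam2.
have S0 : 0 < P r.
  rewrite lt_neqAle (core_flux_ge0 H) ?lexx ?andbT ?(ltW r0) //.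
  by apply: contraTneq Sln => <-; rewrite mul0r -leNgt; lra.
set S := P r in S0 S1 Sln *.
have Y0 : 0 < 2 / S by rewrite divr_gt0.
have [a /andP[a0 ar] [vaY vaE]] := core_level H Y0.
have := core_flux_sqr_le H Y0 a0 ar vaY.
rewrite -/S mulrCA divff ?gt_eqF // mulr1 => /(_ (lexx _)).
set C := lambda * _ * _ * _ => Sq.
have Cle : C <= 45 / 2 * (lambda * expR alpha) * S ^+ 5.
  have r2 : r ^+ 2 <= expR (2 * (- (alpha + 1) / S)).
    rewrite -[X in X ^+ _ <= _]lnK ?posrE // -expRM_natl ler_expR.
    by rewrite ler_pM2l // ler_pdivlMr //; lra.
  (* The sixth power leaves S^5 after division by S; 45 / 4 = 6! / 2^6. *)
  have eS : expR (- (2 / S)) <= 45 / 4 * S ^+ 6.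
    rewrite expRN -[leRHS]invrK lef_pV2 ?posrE ?expR_gt0 ?invr_gt0 //;
      last first.
      by rewrite mulr_gt0 // exprn_gt0.
    have := @expR_ge1Dxn _ _ 5 (ltW Y0).
    have -> : (45 / 4 * S ^+ 6)^-1 = (2 / S) ^+ 6 / 6`!%:R.
      by rewrite !factS fact0; field; lra.
    by apply: le_trans; lra.
  have -> : 45 / 2 * (lambda * expR alpha) * S ^+ 5 =
      lambda * (2 / S) * (expR alpha * (45 / 4 * S ^+ 6)) by field; lra.
  rewrite /C -[leLHS]mulrA; apply: ler_wpM2l.
    by rewrite mulr_ge0 ?(ltW Y0) ?ltW.
  apply: le_trans (ler_wpM2l (expR_ge0 _) r2) _.
  rewrite -expRD.
  have -> : alpha * (1 + 2 / S) + 2 * (- (alpha + 1) / S) = alpha + - (2 / S).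
    by field; lra.
  by rewrite expRD ler_wpM2l ?expR_ge0.
(* 5 / 108 = (45 / 2) / 486. *)
have {}Cle : C <= 5 / 108 * S ^+ 5.
  apply: le_trans Cle _; rewrite ler_pM2r ?exprn_gt0 //; lra.
have C0 : 0 <= C by rewrite !mulr_ge0 ?expR_ge0 ?exprn_ge0 // ?ltW ?invr_gt0.
have {}Sq : S ^+ 2 <= P a ^+ 2 + 5 / 27 * S ^+ 4.
  apply: le_trans Sq _; rewrite lerD2l.
  have : 2 * C * v a <= 2 * C * (2 / S) by rewrite ler_wpM2l // mulr_ge0.
  have : 2 * C * (2 / S) <= 2 * (5 / 108 * S ^+ 5) * (2 / S).
    by rewrite ler_pM2r // ler_pM2l.
  have -> : 2 * (5 / 108 * S ^+ 5) * (2 / S) = 5 / 27 * S ^+ 4 by field; lra.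
  by move=> *; lra.
have S2 : 0 < S ^+ 2 by rewrite exprn_gt0.
have S2le1 : S ^+ 2 <= 1 by rewrite exprn_ile1 // ltW.
have S4 : S ^+ 4 = S ^+ 2 * S ^+ 2 by rewrite -exprD.
have S4le : S ^+ 2 * S ^+ 2 <= S ^+ 2 by rewrite ler_piMr // ltW.
rewrite S4 in Sq; case: vaE => [aE|vaE].
  by move: Sq; rewrite aE (core_P0 H) expr0n /=; lra.
have va1 : 1 <= v a by rewrite vaE ler_pdivlMr //; lra.
have := core_flux_above H a0 ar va1; rewrite vaE.
set p := P a in Sq *; set q := S ^+ 2 in Sq S2 S2le1 S4le.
have p0 : 0 <= p by apply: (core_flux_ge0 H); lra.
have -> : p * (2 * (2 / S) ^+ 2 + 1) = p * (8 + q) / q.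
  by rewrite /q; field; lra.
rewrite ler_pdivrMr // => pq.
have {}pq : p * (8 + q) <= 8 * S.
  suff <- : 4 * (2 / S) * q = 8 * S by [].
  by rewrite /q; field; lra.
have : (p * (8 + q)) ^+ 2 <= (8 * S) ^+ 2.
  by rewrite lerXn2r ?nnegrE ?mulr_ge0 //; lra.
rewrite !exprMn -/q => pq2.
have : q * (8 + q) ^+ 2 <= (p ^+ 2 + 5 / 27 * (q * q)) * (8 + q) ^+ 2.
  by rewrite ler_wpM2r // sqr_ge0.
have : q * q * (8 + q) ^+ 2 <= q * q * 81.
  by rewrite ler_wpM2l ?mulr_ge0 ?ltW //; nra.
have : 0 < q * q by rewrite mulr_gt0.
have : 0 < q * q * q by rewrite !mulr_gt0.
move: pq2; set A := p ^+ 2 * _; rewrite mulrDl -/A -/q.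
lra.
Qed.

End core.

(** * The radial equation on the next nodal domain *)

(** After r the flux decreases, so - v x <= P r * (ln x - ln r), which is at
    most P r * - ln r. If this were <= alpha + 1, then - v would be a subsolution
    of - Delta w <= 2 w. The function psi x = 2 - x ^+ 2 is positive on the
    closed disk with - Delta psi = 4 >= 2 psi, so by a Wronskian argument
    - v / psi is nondecreasing on [r, s], and - v cannot return to 0. *)
Lemma annulus_flux_log_gt alpha beta lambda r s v P :
    0 < alpha -> 0 < beta <= 1 -> 0 < lambda ->
    lambda * expR ((alpha + 1) ^+ 2 + alpha * (alpha + 2)) <= 2 ->
    0 < r -> r < s -> s <= 1 ->
    radial_ode alpha beta lambda s v P -> {within `[r, s], continuous v} ->
    v r = 0 -> v s = 0 -> (forall x, r < x < s -> v x < 0) -> 0 <= P r ->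
  alpha + 1 < P r * - ln r.
Proof.
move=> al0 be01 la0 lam r0 rs s1 ode cv vr vs vlt0 Pr0.
rewrite ltNge; apply/negP => Sln.
have dv x : r <= x < s -> is_derive x 1 v (- P x / x).
  by move=> xrs; have /ode[] : 0 < x < s by lra.
have dP x : r <= x < s ->
    is_derive x 1 P (- (lambda * x * nonlin alpha beta (- v x))).
  move=> xrs; have /ode[_] : 0 < x < s by lra.
  by rewrite nonlinN mulrN opprK.
have cP x : r <= x < s -> {for x, continuous P}.
  by move=> /dP; exact: is_derive_continuous.
have cv' x : r <= x < s -> {for x, continuous v}.
  by move=> /dv; exact: is_derive_continuous.
have Ple x : r <= x < s -> P x <= P r.
  move=> /andP[rx xs]; apply: (@le0_derive_ge _ P
    (fun t => - (lambda * t * nonlin alpha beta (- v t)))) => // [t tx|t tx|].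
  - by apply: dP; lra.
  - have vt : 0 < - v t by rewrite oppr_gt0 vlt0 //; lra.
    rewrite oppr_le0 mulr_ge0 ?(ltW (nonlin_gt0 _ _ vt)) //.
    by rewrite mulr_ge0 //; lra.
  - by apply: within_itv_continuous => t tx; apply: cP; lra.
have vM x : r <= x < s -> - v x <= alpha + 1.
  move=> /andP[rx xs].
  have : v r + P r * ln r <= v x + P r * ln x.
    apply: (@ge0_derive_le _ (fun t => v t + P r * ln t)
        (fun t => - P t / t + (P r * t^-1 + ln t * 0))) => // [t xt|t xt|].
    - have t0 : 0 < t by lra.
      apply: der1D; first by apply: dv; lra.
      exact: der1M (der1_cst (P r) t) (is_derive1_ln t0).
    - rewrite mulr0 addr0 -mulrDl divr_ge0 //; last by lra.
      by have := @Ple t; lra.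
    - apply: within_itv_continuous => t xt.
      apply: cvgD; first by apply: cv'; lra.
      apply: cvgM; first exact: cvg_cst.
      by apply: continuous_ln; lra.
  have : P r * ln x <= 0.
    by rewrite mulr_ge0_le0 // -ln1 ler_ln ?posrE; lra.
  by rewrite vr; lra.
have fle x : r < x < s -> lambda * nonlin alpha beta (- v x) <= 2 * - v x.
  move=> xrs; have vx : 0 < - v x by rewrite oppr_gt0 vlt0.
  have vxM : - v x <= alpha + 1 by apply: vM; lra.
  have := nonlin_le al0 be01 (ltW vx).
  move=> /(ler_wpM2l (ltW la0)) /le_trans; apply.
  rewrite mulrCA mulrC ler_wpM2r ?(ltW vx) //.
  apply: le_trans lam; rewrite ler_pM2l // ler_expR lerD //.
    by rewrite lerXn2r ?nnegrE //; lra.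
  by rewrite ler_pM2l //; lra.
pose psi x := 2 - x ^+ 2.
have psi_gt0 x : r <= x <= s -> 0 < psi x by rewrite /psi; nra.
have dpsi x : is_derive x 1 psi (0 - 2 * x * 1).
  exact: der1B (der1_cst 2 x) (der1_sqr (der1_id x)).
(* x times the Wronskian of - v and psi. *)
pose W x := P x * psi x + 2 * (x ^+ 2 * - v x).
have dw x : r <= x < s -> is_derive x 1 (fun t => - v t) (P x / x).
  move=> /dv dvx; apply: (is_derive_eq (is_deriveN dvx)).
  by rewrite mulNr opprK.
have dW x : r <= x < s -> is_derive x 1 W
   (x * (4 * - v x - lambda * nonlin alpha beta (- v x) * psi x)).
  move=> xrs; have x0 : x != 0 by lra.
  apply: (is_derive_eq (der1D (der1M (dP _ xrs) (dpsi x))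
    (der1M (der1_cst 2 x) (der1M (der1_sqr (der1_id x)) (dw _ xrs))))).
  by rewrite /psi; field.
have W_ge0 x : r <= x < s -> 0 <= W x.
  move=> /andP[rx xs]; have : W r <= W x.
    apply: (ge0_derive_le rx (fun t tx => dW t _)) => [t tx|t tx|].
    - by lra.
    - rewrite mulr_ge0 //; first lra.
      have := fle t; have := vlt0 t; have := psi_gt0 t; rewrite /psi.
      by nra.
    - apply: within_itv_continuous => t tx; apply: is_derive_continuous.
      by apply: dW; lra.
  apply: le_trans; rewrite /W vr oppr0 !mulr0 addr0 mulr_ge0 //.
  by apply/ltW/psi_gt0; lra.
pose m := (r + s) / 2.
have mrs : r < m < s by rewrite /m; lra.
have : - v m / psi m <= - v s / psi s.
  apply: (@ge0_derive_le _ (fun t => - v t / psi t)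
    (fun t => W t / t / psi t ^+ 2)) => [|t tx|t tx|].
  - by lra.
  - have trs : r <= t < s by lra.
    have psit : psi t != 0 by rewrite gt_eqF // psi_gt0; lra.
    have t0 : t != 0 by lra.
    apply: (is_derive_eq (der1M (dw _ trs) (der1V psit (dpsi t)))).
    by rewrite /W; field; rewrite t0 psit.
  - by rewrite !divr_ge0 ?sqr_ge0 ?W_ge0 //; lra.
  - have cv2 : {within `[m, s], continuous v}.
      by apply: continuous_subspaceW cv => x; rewrite /= !in_itv /=; lra.
    move=> x; apply: cvgM; first by apply: cvgN; exact: cv2.
    have : {within `[m, s], continuous (fun t => (psi t)^-1)}.
      apply: within_itv_continuous => t tms; apply: cvgV.
        by rewrite gt_eqF // psi_gt0; lra.
      exact: is_derive_continuous (dpsi t).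
    exact.
apply/negP; rewrite vs oppr0 mul0r -ltNge divr_gt0 ?psi_gt0 //; last lra.
by rewrite oppr_gt0 vlt0.
Qed.

End radial_equation.

(** * From the partial differential equation to the radial one *)

Section polar.
Context {R : realType}.
Implicit Types (r s t x y z : R) (g u : R * R -> R) (alpha beta lambda : R).

Lemma is_derive_slice1 g x y : derivable g (x, y) e1 ->
  is_derive x 1 (fun t => g (t, y)) ('D_e1 g (x, y)).
Proof.
have gE : (fun h : R => h^-1 *: (g (h *: e1 + (x, y)) - g (x, y))) =
    (fun h : R => h^-1 *: (g (h *: (1 : R) + x, y) - g (x, y))).
  by apply/funext => h; congr (_ *: (g (_, _) - _)); rewrite /= ?scaler0 ?add0r.
by rewrite /derivable /derive gE => dg; split.
Qed.

Lemma is_derive_slice2 g x y : derivable g (x, y) e2 ->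
  is_derive y 1 (fun t => g (x, t)) ('D_e2 g (x, y)).
Proof.
have gE : (fun h : R => h^-1 *: (g (h *: e2 + (x, y)) - g (x, y))) =
    (fun h : R => h^-1 *: (g (x, h *: (1 : R) + y) - g (x, y))).
  by apply/funext => h; congr (_ *: (g (_, _) - _)); rewrite /= ?scaler0 ?add0r.
by rewrite /derivable /derive gE => dg; split.
Qed.

Lemma norm2_axis x : norm2 (x, 0) = `|x|.
Proof. by rewrite /norm2 /= expr0n addr0 sqrtr_sqr. Qed.

Lemma is_derive_norm2 x y : 0 < x ->
  is_derive y 1 (fun t => norm2 (x, t)) (y / norm2 (x, y)).
Proof.
move=> x0; have s0 : 0 < x ^+ 2 + y ^+ 2.
  by rewrite ltr_wpDr ?sqr_ge0 ?exprn_gt0.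
have dq := der1D (der1_cst (x ^+ 2) y) (der1_sqr (der1_id y)).
have := der1_comp (g := fun t => x ^+ 2 + t ^+ 2) (is_derive1_sqrt s0) dq.
move/is_derive_eq; apply; rewrite /norm2 /=.
have : Num.sqrt (x ^+ 2 + y ^+ 2) != 0 by rewrite gt_eqF // sqrtr_gt0.
by move=> ?; field.
Qed.

Lemma near_disk x y : 0 < x -> disk (x, y) -> \forall t \near y, disk (x, t).
Proof.
move=> x0 dxy.
have cy := is_derive_continuous (is_derive_norm2 y x0).
have := @cvgr_lt _ _ _ _ _ _ cy 1 dxy.
exact.
Qed.

(** Near (x, 0), u (x, y) = u (rho y, 0) with rho y = norm2 (x, y), so the
    partial derivative in y is d (rho y) * (y / rho y) with d = 'D_e1 u along the
    axis; differentiating at y = 0 leaves d x / x. *)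
Lemma radial_angular_derivative u : class_C 2 disk u -> radial_on disk u ->
  forall x, 0 < x < 1 -> 'D_e2 ('D_e2 u) (x, 0) = 'D_e1 u (x, 0) / x.
Proof.
move=> [_ [du [_ [dd1 _ _]] [_ [dd2 _ _]]]] rad x /andP[x0 x1].
pose d t := 'D_e1 u (t, 0).
pose rho t := norm2 (x, t).
have disk_axis t : 0 <= t < 1 -> disk (t, 0).
  by move=> /andP[t0 t1]; rewrite /disk /= norm2_axis ger0_norm.
have rho_gt0 t : 0 < rho t.
  by rewrite sqrtr_gt0 ltr_wpDr ?sqr_ge0 ?exprn_gt0.
have rhoE t : norm2 (rho t, 0) = rho t by rewrite norm2_axis gtr0_norm.
have d2E y : disk (x, y) -> 'D_e2 u (x, y) = d (rho y) * (y / rho y).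
  move=> dxy; have uy := is_derive_slice2 (du _ dxy).2.
  have axy : disk (rho y, 0) by rewrite /disk /= rhoE.
  have vy := is_derive_slice1 (du _ axy).1.
  have vrho := der1_comp vy (is_derive_norm2 y x0).
  have [_ <-] := uy.
  have [_ <- //] :
    is_derive y 1 (fun t => u (x, t)) (d (rho y) * (y / rho y)).
  apply: near_eq_is_derive vrho.
  near=> t; apply: rad; last exact: rhoE.
    by rewrite /disk /= rhoE; near: t; exact: near_disk.
  by near: t; exact: near_disk.
have dx0 : disk (x, 0) by apply: disk_axis; rewrite x1 ltW.
have rho0 : rho 0 = x by rewrite /rho norm2_axis gtr0_norm.
have [_ <-] := is_derive_slice2 (dd2 _ dx0).2.
have drho : is_derive (0 : R) 1 rho (0 / norm2 (x, 0)) := is_derive_norm2 0 x0.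
have ddx : is_derive (rho 0) 1 d ('D_e1 ('D_e1 u) (rho 0, 0)).
  by rewrite rho0; exact: is_derive_slice1 (dd1 _ dx0).1.
have rho_neq0 : rho 0 != 0 by rewrite gt_eqF.
have := der1M (der1_comp ddx drho)
  (der1M (der1_id 0) (der1V rho_neq0 drho)).
set l := (X in is_derive _ _ _ X) => dl.
have [_ ->] : is_derive (0 : R) 1 (fun t => 'D_e2 u (x, t)) l.
  apply: near_eq_is_derive dl; near=> t; rewrite d2E //.
  by near: t; exact: near_disk.
by rewrite /l !(mul0r, add0r, addr0, mulr1) rho0.
Unshelve. all: by end_near.
Qed.

Lemma within_slice1 (A : set (R * R)) g a b :
    {within A, continuous g} -> (forall t, a <= t <= b -> A (t, 0)) ->
  {within `[a, b], continuous (fun t => g (t, 0))}.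
Proof.
move=> /subspace_continuousP cg abA; apply/subspace_continuousP => x.
rewrite /= in_itv /= => /abA Ax B /(cg _ Ax).
have ct : (fun t : R => (t, 0 : R)) t @[t --> x] --> (x, 0 : R).
  exact: (cvg_pair cvg_id (cvg_cst _)).
move=> gB; have {}gB : nbhs x [set t | A (t, 0) -> B (g (t, 0))] := ct _ gB.
change (nbhs x [set t | `[a, b]%classic t -> B (g (t, 0))]).
by apply: (@filterS _ _ (nbhs_filter x)) gB => t gB;
  rewrite /= in_itv /= => /abA /gB.
Qed.

(** v is u on a ray, multiplied by the sign of u at the origin, which preserves
    the equation as f is odd. Only the two innermost nodal domains are kept. *)
Lemma nodal_radial_ode alpha beta lambda k u : 0 < alpha -> 0 < beta <= 1 ->
    0 < lambda -> (1 <= k)%N -> S_ alpha beta lambda k u ->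
  exists r s v P, [/\ positive_core alpha beta lambda r v P,
    r < s, s <= 1 & [/\ radial_ode alpha beta lambda s v P,
      {within `[r, s], continuous v}, v s = 0 &
      forall x, r < x < s -> v x < 0]].
Proof.
move=> al0 be01 la0 k1 [[cu2 cu pde _] rad [rr [rr0 rr1 rrlt] Hr]].
have /Hr[/=] : (1 <= 1 <= k.+1)%N by [].
have /Hr[/=] : (1 <= 2 <= k.+1)%N by apply/andP.
set r := rr 1%N; set s := rr 2%N; set sg := Num.sg _.
rewrite rr0 => us us_sgn ur ur_sgn.
have r0 : 0 < r by rewrite -rr0 rrlt.
have rs : r < s by rewrite rrlt // ltnW.
have s1 : s <= 1.
  have mono n : (2 <= n)%N -> (n <= k.+1)%N -> s <= rr n.
    elim: n => // n IH; rewrite leq_eqVlt => /predU1P[<- //|n2 nk].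
    by apply: le_trans (IH n2 (ltnW nk)) _; rewrite ltW // rrlt.
  by rewrite -rr1 mono.
(* The sign condition at one point of the innermost domain excludes u 0 = 0. *)
have sg0 : sg != 0.
  apply/eqP => sg0; have := ur_sgn (r / 2, 0); rewrite sg0 !mul0r ltxx.
  by move=> /(_ _)/notF; apply; rewrite /annulus /= norm2_axis ger0_norm; lra.
have u0 : u (0, 0) != 0 by rewrite -sgr_eq0.
have fsg y : sg * nonlin alpha beta y = nonlin alpha beta (sg * y).
  rewrite /sg; case: sgrP => //; rewrite ?mul1r ?mulN1r ?mul0r ?nonlinN //.
  by rewrite /nonlin mul0r.
have axis x : 0 <= x -> norm2 (x, 0) = x.
  by move=> x0; rewrite norm2_axis ger0_norm.
have disk_axis x : 0 <= x < 1 -> disk (x, 0).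
  by move=> /andP[x0 x1]; rewrite /disk /= axis.
have du x : 0 <= x < 1 ->
    is_derive x 1 (fun t => u (t, 0)) ('D_e1 u (x, 0)).
  by case: cu2 => _ [du _ _] /disk_axis /du[] /is_derive_slice1.
have ddu x : 0 <= x < 1 ->
    is_derive x 1 (fun t => 'D_e1 u (t, 0)) ('D_e1 ('D_e1 u) (x, 0)).
  by case: cu2 => _ [_ [_ [dd _ _]] _] /disk_axis /dd[] /is_derive_slice1.
pose v x := sg * u (x, 0).
pose P x := - (sg * (x * 'D_e1 u (x, 0))).
have dv x : 0 <= x < 1 -> is_derive x 1 v (sg * 'D_e1 u (x, 0)).
  move=> /du dux; apply: (is_derive_eq (der1M (der1_cst sg x) dux)).
  by rewrite mulr0 addr0.
have dP x : 0 <= x < 1 -> is_derive x 1 P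
    (- (sg * ('D_e1 u (x, 0) + x * 'D_e1 ('D_e1 u) (x, 0)))).
  move=> /ddu ddux.
  apply: (is_derive_eq (is_deriveN (der1M (der1_cst sg x)
    (der1M (der1_id x) ddux)))).
  by congr (- _); ring.
have ode : radial_ode alpha beta lambda s v P.
  move=> x xs; have x1 : 0 <= x < 1 by lra.
  have x0 : x != 0 by lra.
  split.
    by apply: (is_derive_eq (dv x x1)); rewrite /P opprK; field.
  apply: (is_derive_eq (dP x x1)).
  have := pde _ (disk_axis _ x1); rewrite /laplacian.
  rewrite (radial_angular_derivative cu2); last by lra.
    rewrite -mulrA -/(nonlin alpha beta (u (x, 0))) => pdex.
    rewrite /v -fsg mulrCA -(mulrA lambda) (mulrCA lambda) -pdex.
    by field.
  by move=> p q dp dq; apply: rad; exact: ltW.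
have z01 : 0 <= (0 : R) < 1 by lra.
exists r, s, v, P; split => //.
- split => //.
  + by lra.
  + by exists s.
  + exact: is_derive_continuous (dv _ z01).
  + exact: is_derive_continuous (dP _ z01).
  + by rewrite /P mul0r mulr0 oppr0.
  + by rewrite /v ur ?mulr0 // axis // ltW.
  + move=> x /andP[]; rewrite le_eqVlt => /predU1P[<- _|x0 xr].
      by rewrite /v /sg -normrEsg normr_gt0.
    have := ur_sgn (x, 0); rewrite expr0 mulr1; apply.
    by rewrite /annulus /= axis ?ltW // x0.
- split => //.
  + move=> x; apply: cvgM; first exact: cvg_cst.
    apply: (within_slice1 cu) => t trs.
    by rewrite /cdisk /= axis; lra.
  + by rewrite /v us ?mulr0 // axis; lra.
  + move=> x xrs; have := us_sgn (x, 0); rewrite expr1 mulrN1 mulNr oppr_gt0.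
    by apply; rewrite /annulus /= axis; lra.
Qed.

End polar.

(** * Nonexistence for small lambda *)

(** The two domains impose incompatible bounds on P r * ln (1 / r). *)
Lemma no_radial_nodal_solution (R : realType) (alpha beta : R) :
    0 < alpha -> 0 < beta <= 1 ->
  exists2 lambda_hat : R, 0 < lambda_hat &
    forall lambda k (u : R * R -> R), 0 < lambda < lambda_hat -> (1 <= k)%N ->
      ~ S_ alpha beta lambda k u.
Proof.
move=> al0 be01.
pose A := expR ((alpha + 1) ^+ 2 + alpha * (alpha + 2)).
pose B := 9 * nonlin alpha beta 2.
pose C := 486 * expR alpha.
have A0 : 0 < A by exact: expR_gt0.
have B0 : 0 < B by rewrite mulr_gt0 ?nonlin_gt0.
have C0 : 0 < C by apply: mulr_gt0; [lra|exact: expR_gt0].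
exists (Num.min (2 / A) (Num.min (2 / B) (1 / C))).
  by rewrite !lt_min !divr_gt0.
move=> lambda k u; rewrite !lt_min => /andP[la0 /and3P[]].
rewrite !ltr_pdivlMr // => /ltW lA /ltW lB /ltW lC k1.
move=> /(nodal_radial_ode al0 be01 la0 k1).
move=> [r [s [v [P [core rs s1 [ode cv vs vlt0]]]]]].
have [r0 r1] := andP (core_r core).
have : P r * - ln r <= alpha + 1.
  apply: (core_flux_log_le core); first by rewrite /B in lB; lra.
  by rewrite /C in lC; lra.
apply/negP; rewrite -ltNge.
have vr := core_vr core.
apply: (annulus_flux_log_gt al0 be01 la0 lA r0 rs s1 ode cv vr vs vlt0).
by apply: (core_flux_ge0 core); rewrite lexx ltW.
Qed.

Theorem corollary1p3 (R : realType) (alpha : R) (halpha : 0 < alpha)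
    (beta : R) (hbeta : 0 < beta <= 1) :
  (forall E : R, 0 < E ->
     exists2 lambda_hat : R, 0 < lambda_hat &
       forall lambda : R, 0 < lambda < lambda_hat ->
         ~ exists u : R * R -> R,
             radial_nodal_solution alpha beta lambda u /\
             (dirichlet u <= E%:E)%E) /\
  (forall k : nat, (1 <= k)%N ->
     exists2 lambda_hat0 : R, 0 < lambda_hat0 &
       forall lambda : R, 0 < lambda < lambda_hat0 ->
         ~ exists u : R * R -> R,
             S_ alpha beta lambda k u /\
             (energy alpha beta lambda u)%:E = c_level alpha beta lambda k).
Proof.
have [lh lh0 noS] := no_radial_nodal_solution halpha hbeta.
split=> [E E0|k k1]; exists lh => // lambda lambdaP.
  by move=> [u [[k k1 uS] _]]; exact: noS lambdaP k1 uS.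
by move=> [u [uS _]]; exact: noS lambdaP k1 uS.
Qed.
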